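(* Let $(\mathfrak{A}, G, \Theta)$ be a C*-dynamical system with $\mathfrak{A}$ separable and $G$ amenable. Let $\mathbf{F} = (F_k)_{k=1}^\infty$ be a right Følner sequence for $G$, and let $S$ be a nonempty subset of the state space $\mathcal{S}$ of $\mathfrak{A}$. Let $x \in \mathfrak{A}$ be self-adjoint, and let $\lambda \in \mathbb{R}$. Then the following are equivalent. (i) $\{ \psi(x) : \psi \in \mathscr{P}^{\mathbf{F}}(S) \} = \{\lambda\}$. (ii) $\lim_{k \to \infty} \left\| \operatorname{Avg}_{F_k} x - \lambda 1 \right\|_S = 0$.
   Context: A C*-dynamical system $(\mathfrak{A}, G, \Theta)$ consists of a unital C*-algebra $\mathfrak{A}$, a topological group $G$, and a left action $\Theta : G \to \operatorname{Aut}(\mathfrak{A})$ by *-automorphisms that is continuous for the point-norm topology. $\mathcal{S}$ denotes the set of states of $\mathfrak{A}$ with the weak*-topology. For a nonempty finite $F \subseteq G$, $\operatorname{Avg}_F x = \frac{1}{|F|} \sum_{g \in F} \Theta_g x$. A right Følner sequence for $G$ is a sequence $(F_k)_{k=1}^\infty$ of nonempty finite subsets of $G$ with $|F_k g \,\Delta\, F_k| / |F_k| \to 0$ for every $g \in G$. For $S \subseteq \mathcal{S}$, $\mathscr{P}^{\mathbf{F}}(S)$ denotes the set of all weak*-limit points (limits of weak*-convergent subsequences) of sequences of the form $(\phi_k \circ \operatorname{Avg}_{F_k})_{k=1}^\infty$ with $\phi_k \in S$ for all $k$. For nonempty $S \subseteq \mathcal{S}$, the seminorm $\|\cdot\|_S$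 on $\mathfrak{A}$ is $\|x\|_S = \sup_{\phi \in S} |\phi(x)|$. *)

(* Defs.v *)
From HB Require Import structures.
From mathcomp Require Import all_boot all_order all_algebra finmap.
From mathcomp Require Import all_classical all_reals all_analysis.
From mathcomp Require Import complex.

Set Implicit Arguments.
Unset Strict Implicit.
Unset Printing Implicit Defensive.

Import Order.TTheory GRing.Theory Num.Theory.
Import numFieldNormedType.Exports.

Local Open Scope classical_set_scope.
Local Open Scope complex_scope.
Local Open Scope ring_scope.

(* Unital C*-algebras over R[i], on top of the complex Banach spaces
   [completeNormedModType R[i]], whose norm takes nonnegative real values in
   R[i].  The multiplication is part of the mixin because Hierarchy Builder
   rejects a join of [NormedModule] and [GRing.Algebra]: [Num.NumDomain] is
   already a join of rings and normed groups.  The zero algebra is allowed. *)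
HB.mixin Record isCStarAlgebra (R : realType) A
    & CompleteNormedModule R[i] A := {
  cmul : A -> A -> A;
  cone : A;
  star : A -> A;
  cmulA : associative cmul;
  cmul1x : left_id cone cmul;
  cmulx1 : right_id cone cmul;
  cmulDl : left_distributive cmul +%R;
  cmulDr : right_distributive cmul +%R;
  cmulZl : forall (c : R[i]) (x y : A), cmul (c *: x) y = c *: cmul x y;
  cmulZr : forall (c : R[i]) (x y : A), cmul x (c *: y) = c *: cmul x y;
  starD : {morph star : x y / x + y};
  starZ : forall (c : R[i]) (x : A), star (c *: x) = c^* *: star x;
  starM : forall x y : A, star (cmul x y) = cmul (star y) (star x);
  starK : involutive star;
  norm_cmul_le : forall x y : A, `|cmul x y| <= `|x| * `|y|;
  norm_cmul_star : forall x : A, `|cmul (star x) x| = `|x| ^+ 2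
}.

#[short(type="cstarAlgType")]
HB.structure Definition CStarAlgebra (R : realType) :=
  {A of CompleteNormedModule R[i] A & isCStarAlgebra R A}.

Arguments cone {R s}.

HB.mixin Record isTopologicalGroup G & Topological G & Group G := {
  mulg_continuous : continuous (fun p : G * G => (p.1 * p.2)%g);
  invg_continuous : continuous (fun g : G => (g^-1)%g)
}.

#[short(type="topologicalGroupType")]
HB.structure Definition TopologicalGroup :=
  {G of Topological G & Group G & isTopologicalGroup G}.

Definition separable_space (T : topologicalType) : Prop :=
  exists2 D : set T, countable D & dense D.

Section Amenability.
Context (R : realType) (G : topologicalGroupType).

(* Bounded functions that are uniformly continuous for the right uniformity
   of G.  A left invariant mean on them is the notion of amenability that
   makes sense for every topological group; for discrete G all bounded
   functions qualify, and it is the usual invariant mean. *)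
Definition bounded_right_ucont (f : G -> R) : Prop :=
  (exists M : R, forall g, `|f g| <= M) /\
  (forall e : R, 0 < e ->
     \forall h \near nbhs (1%g : G), forall g, `|f (h * g)%g - f g| <= e).

Definition left_invariant_mean (m : (G -> R) -> R) : Prop :=
  [/\ forall (a : R) (f1 f2 : G -> R),
        bounded_right_ucont f1 -> bounded_right_ucont f2 ->
        m (fun g => a * f1 g + f2 g) = a * m f1 + m f2,
      forall f, bounded_right_ucont f -> (forall g, 0 <= f g) -> 0 <= m f,
      m (fun=> 1) = 1
    & forall (h : G) (f : G -> R), bounded_right_ucont f ->
        m (fun g => f (h * g)%g) = m f].

Definition amenable : Prop := exists m, left_invariant_mean m.

Local Open Scope fset_scope.

Definition fset_rtrans (F : {fset G}) (g : G) : {fset G} :=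
  [fset (h * g)%g | h in F].

Definition fset_symdiff (E F : {fset G}) : {fset G} :=
  (E `\` F) `|` (F `\` E).

(* Sequences are indexed from 0. *)
Definition right_folner (F : nat -> {fset G}) : Prop :=
  (forall k, F k != fset0) /\
  (forall g : G,
     (fun k => #|` fset_symdiff (fset_rtrans (F k) g) (F k)|%:R
               / #|` F k|%:R : R) @ \oo --> (0 : R)).

End Amenability.

Section CStarDynamics.
Context (R : realType) (A : cstarAlgType R) (G : topologicalGroupType).

Definition self_adjoint (x : A) : Prop := star x = x.

(* Preservation of [cone] follows from surjectivity and multiplicativity. *)
Definition star_automorphism (f : {linear A -> A}) : Prop :=
  [/\ bijective f, {morph f : x y / cmul x y} & {morph f : x / star x}].

Definition cstar_dynamical_system (Theta : G -> {linear A -> A}) : Prop :=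
  [/\ forall g, star_automorphism (Theta g),
      forall x, Theta 1%g x = x,
      forall g h x, Theta (g * h)%g x = Theta g (Theta h x)
    & forall x, continuous (fun g => Theta g x)].

(* The topology of {ptws A -> R[i]^o} induces the weak* topology on states. *)
Definition states : set {ptws A -> R[i]^o} :=
  [set phi | [/\ scalar (phi : A -> R[i]),
                 forall a : A, 0 <= phi (cmul (star a) a)
               & phi cone = 1]].

Definition Avg (Theta : G -> {linear A -> A}) (F : {fset G}) (x : A) : A :=
  (#|` F|%:R : R[i])^-1 *: \sum_(g <- F) Theta g x.

Definition limit_states (Theta : G -> {linear A -> A})
    (F : nat -> {fset G}) (S : set {ptws A -> R[i]^o}) :
    set {ptws A -> R[i]^o} :=
  [set psi | states psi /\
     exists (phi : nat -> {ptws A -> R[i]^o}) (n : nat -> nat),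
       [/\ forall k, S (phi k),
           {homo n : i j / (i < j)%N}
         & {ptws, (fun j => phi (n j) \o Avg Theta (F (n j))) @ \oo --> psi}]].

(* A supremum of reals: it is finite for nonempty S `<=` states, since then
   |phi x| is bounded by the norm of x. *)
Definition seminorm (S : set {ptws A -> R[i]^o}) (x : A) : R :=
  sup [set ComplexField.Normc.normc (phi x) | phi in S].

End CStarDynamics.

Arguments states {R} A.

(* Main.v *)
Require Import Defs.
From HB Require Import structures.
From mathcomp Require Import all_boot all_order all_algebra finmap.
From mathcomp Require Import all_classical all_reals all_analysis.
From mathcomp Require Import complex lra.
Set Implicit Arguments.
Unset Strict Implicit.
Unset Printing Implicit Defensive.
Import Order.TTheory GRing.Theory Num.Theory.
Import numFieldNormedType.Exports.
Local Open Scope classical_set_scope.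
Local Open Scope complex_scope.
Local Open Scope ring_scope.

(** States send the unit to 1, so for a state phi in S the number
phi (Avg x - lambda 1) is (phi \o Avg)(x) - lambda: the seminorm of
Avg x - lambda 1 measures how far the values at x of the averaged states
phi \o Avg, phi in S, are from lambda.

If these seminorms tend to 0, then the values at x of any subsequence of
averaged states tend to lambda, so every limit state has the value lambda, and
there is at least one limit state by compactness.  If they do not tend to 0,
they stay above some e > 0 for infinitely many indices k; choosing phi_k in S
that attains at least half of the seminorm, compactness provides a limit
state along a subsequence of those indices, and its value at x is at
distance at least e / 2 from lambda.

Averages of states are states ([state_Avg]), so all that is needed is the
sequential weak* compactness of the state space of a separable algebra, along a
prescribed infinite set of indices ([states_seq_compact]).  It rests on two
facts.

- States are uniformly bounded ([state_bound]).  They are defined by positivity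
  alone, so this has to come from the algebra: a self-adjoint a of norm at most
  1/2 satisfies 1 - a = b^* b for some b, hence phi a <= 1.  The square root b
  is 1 - c, where c is the fixed point of c |-> (a + c^2) / 2, a contraction
  of the ball of radius 1/2 ([sqrt_fixpoint], [one_sub_square]).

- Along an ultrafilter every bounded sequence of complex numbers converges,
  which defines a limit state psi at once on the whole algebra.  Each neighbourhood
  condition on psi then holds for some arbitrarily large index, so an increasing
  sequence of indices can be chosen along which the states converge to psi on
  a countable dense set, hence everywhere by the uniform bound. *)

(** * The norm as a real number *)

Section RealNorm.
Context {R : realType}.

(** Norms over [R[i]] take values in [R[i]], whose order is only partial.  Their
real parts live in an ordered field, where linear arithmetic is available. *)
Definition rnorm {V : normedZmodType R[i]} (x : V) : R := complex.Re `|x|.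

Section Zmod.
Context {V : normedZmodType R[i]}.
Implicit Types x y : V.

Lemma rnormE x : `|x| = (rnorm x)%:C.
Proof. by rewrite /rnorm RRe_real// normr_real. Qed.

Lemma rnorm_ge0 x : 0 <= rnorm x.
Proof. by rewrite -ler0c -rnormE. Qed.

Lemma rnorm0 : rnorm (0 : V) = 0.
Proof. by rewrite /rnorm normr0. Qed.

Lemma rnorm0_eq0 x : rnorm x = 0 -> x = 0.
Proof. by move=> x0; apply/normr0_eq0; rewrite rnormE x0. Qed.

Lemma rnormD x y : rnorm (x + y) <= rnorm x + rnorm y.
Proof. by rewrite -lecR rmorphD/= -!rnormE ler_normD. Qed.

Lemma rnormN x : rnorm (- x) = rnorm x.
Proof. by rewrite /rnorm normrN. Qed.

Lemma rdistC x y : rnorm (x - y) = rnorm (y - x).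
Proof. by rewrite /rnorm distrC. Qed.

Lemma rnorm_dist3 (u v w z : V) (e1 e2 e3 : R) :
  rnorm (u - v) <= e1 -> rnorm (v - w) < e2 -> rnorm (w - z) <= e3 ->
  rnorm (u - z) < e1 + e2 + e3.
Proof.
have := rnormD (u - v) (v - w); have := rnormD (u - w) (w - z).
rewrite !addrA !subrK; lra.
Qed.

End Zmod.

Lemma rnormc (z : R[i]) : rnorm z = ComplexField.Normc.normc z.
Proof. by case: z. Qed.

Lemma rnormZ {V : normedModType R[i]} (c : R[i]) (x : V) :
  rnorm (c *: x) = rnorm c * rnorm x.
Proof. by apply: complexI; rewrite rmorphM/= -!rnormE normrZ. Qed.

Lemma rnormM (z w : R[i]) : rnorm (z * w) = rnorm z * rnorm w.
Proof. by apply: complexI; rewrite rmorphM/= -!rnormE normrM. Qed.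

Lemma rnorm_i : rnorm ('i : R[i]) = 1.
Proof. by rewrite rnormc/= expr0n/= add0r expr1n sqrtr1. Qed.

Lemma rnormC (r : R) : rnorm (r%:C) = `|r|.
Proof. by rewrite rnormc/= expr0n/= addr0 sqrtr_sqr. Qed.

Lemma rnorm_Re (z : R[i]) : `|complex.Re z| <= rnorm z.
Proof. by rewrite -lecR -rnormE normc_ge_Re. Qed.

Lemma rnorm_Im (z : R[i]) : `|complex.Im z| <= rnorm z.
Proof.
have := rnorm_Re (z * 'i%C); rewrite ReiNIm normrN => /le_trans; apply.
by rewrite rnormM rnorm_i mulr1.
Qed.

Lemma rnorm_ReIm (z : R[i]) : rnorm z <= `|complex.Re z| + `|complex.Im z|.
Proof.
rewrite {1}(complexE z); apply: le_trans (rnormD _ _) _.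
by rewrite rnormM rnorm_i mul1r !rnormC.
Qed.

Lemma cvg_rnormP {V : normedModType R[i]} {T : Type} (F : set_system T)
    {FF : Filter F} (f : T -> V) (l : V) :
  f @ F --> l <->
  (forall e : R, 0 < e -> \forall t \near F, rnorm (l - f t) < e).
Proof.
split=> [/cvgrPdist_lt fl e e0|fl].
  have := fl e%:C; rewrite ltcR => /(_ e0); apply: filterS => t.
  by rewrite rnormE ltcR.
apply/cvgrPdist_lt => e e0.
have eE : e = (complex.Re e)%:C by rewrite RRe_real// gtr0_real.
rewrite eE; move: e0; rewrite eE ltcR => /fl; apply: filterS => t.
by rewrite rnormE ltcR.
Qed.

(** Closed disks are compact; applied to real and imaginary parts, this is
compactness of segments. *)
Lemma ultra_cvg_bounded {T : Type} (U : set_system T) (UU : UltraFilter U)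
    (f : T -> R[i]^o) (M : R) :
  (forall t, rnorm (f t : R[i]) <= M) -> exists z : R[i]^o, f @ U --> z.
Proof.
move=> fM.
have real_cvg (h : T -> R) : (forall t, `|h t| <= M) ->
    exists r : R, h @ U --> r.
  move=> hM; have := @segment_compact R (- M) M; rewrite compact_ultra.
  (* the image of an ultrafilter is an ultrafilter *)
  have hU : UltraFilter (h @ U).
    split=> [|G GF hG]; first exact: fmap_proper_filter.
    apply/seteqP; split=> // B GB.
    have [//|UB] := in_ultra_setVsetC (h @^-1` B) UU.
    have GB' : G (~` B) by apply: hG; exact: UB.
    by have [? []] := filter_ex (filterI GB GB').
  move=> /(_ _ hU)[|r [_ hr]]; last by exists r.
  apply: (@filterS _ U _ setT); last exact: filterT.
  by move=> t _ /=; rewrite in_itv/= -ler_norml.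
have [|u fu] := real_cvg (fun t => complex.Re (f t)).
  by move=> t; apply: le_trans (fM t); exact: rnorm_Re.
have [|v fv] := real_cvg (fun t => complex.Im (f t)).
  by move=> t; apply: le_trans (fM t); exact: rnorm_Im.
exists (u +i* v)%C; apply/(@cvg_rnormP R[i]^o) => e e0.
have e20 : 0 < e / 2 by rewrite divr_gt0.
move/cvgrPdist_lt : fu => /(_ _ e20) fu.
move/cvgrPdist_lt : fv => /(_ _ e20) fv.
apply: filterS2 fu fv => t; have := rnorm_ReIm ((u +i* v)%C - f t).
by case: (f t) => x y /=; lra.
Qed.

Lemma cvg_uniqueC {T : Type} (F : set_system T) {FF : ProperFilter F}
    (f : T -> R[i]^o) (z w : R[i]^o) : f @ F --> z -> f @ F --> w -> z = w.
Proof. by apply: cvg_unique; exact: norm_hausdorff. Qed.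

Lemma cvg_ge0C {T : Type} (F : set_system T) {FF : ProperFilter F}
    (f : T -> R[i]^o) (z : R[i]^o) :
  (forall t, 0 <= (f t : R[i])) -> f @ F --> z -> 0 <= (z : R[i]).
Proof.
move=> f0 /cvg_rnormP fz.
have apx e : 0 < e -> exists2 r : R, 0 <= r & rnorm (z - r%:C : R[i]) < e.
  move=> /fz/filter_ex[t]; have := f0 t; case: (f t) => x y.
  by rewrite lecE/= => /andP[/eqP-> x0] zt; exists x.
rewrite lecE/=; apply/andP; split.
  rewrite -normr_eq0 eq_le normr_ge0 andbT; apply/ler_addgt0Pr => e /apx[r _].
  have := rnorm_Im (z - r%:C : R[i]).
  by case: z {fz apx} => x y /=; rewrite subr0 => *; lra.
apply/ler_addgt0Pr => e /apx[r r0]; have := rnorm_Re (z - r%:C : R[i]).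
case: z {fz apx} => x y /=; rewrite ler_norml => /andP[]; lra.
Qed.

End RealNorm.

(** * Square roots close to the unit *)

Section CStar.
Context {R : realType} {A : cstarAlgType R}.
Implicit Types a b c x y : A.
Local Notation "x ** y" := (cmul x y) (at level 40, left associativity).
Local Notation "1A" := (cone : A).

Lemma cmulNl x y : (- x) ** y = - (x ** y).
Proof. by rewrite -scaleN1r cmulZl scaleN1r. Qed.

Lemma cmulNr x y : x ** (- y) = - (x ** y).
Proof. by rewrite -scaleN1r cmulZr scaleN1r. Qed.

Lemma starN x : star (- x) = - star x.
Proof. by rewrite -scaleN1r starZ rmorphN1 scaleN1r. Qed.

Lemma star_cone : star 1A = 1A.
Proof. by rewrite -[LHS]cmulx1 -[X in _ ** X]starK -starM cmulx1 starK. Qed.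

Lemma rnorm_cmul x y : rnorm (x ** y) <= rnorm x * rnorm y.
Proof. by rewrite -lecR rmorphM/= -!rnormE norm_cmul_le. Qed.

(** The C*-identity and submultiplicativity give |y|^2 <= |y^*| |y|. *)
Lemma rnorm_star x : rnorm (star x) = rnorm x.
Proof.
suff le_star y : rnorm y <= rnorm (star y).
  by apply/eqP; rewrite eq_le le_star -{2}[x]starK le_star.
have [->|y0] := eqVneq (rnorm y) 0; first exact: rnorm_ge0.
have yy : rnorm (star y ** y) = rnorm y ^+ 2.
  by apply: complexI; rewrite -rnormE norm_cmul_star rmorphXn/= rnormE.
have ygt0 : 0 < rnorm y by rewrite lt_def y0 rnorm_ge0.
by rewrite -(ler_pM2r ygt0) -expr2 -yy rnorm_cmul.
Qed.

(** At a fixed point c of this map, (1 - c)^2 = 1 - a. *)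
Definition sqrt_step a c : A := (2^-1 : R)%:C *: (a + c ** c).

Lemma sqrt_step_ball a c : rnorm a <= 2^-1 -> rnorm c <= 2^-1 ->
  rnorm (sqrt_step a c) <= 2^-1.
Proof.
move=> a2 c2; rewrite rnormZ rnormC ger0_norm//.
have := rnormD a (c ** c); have := rnorm_cmul c c; have := rnorm_ge0 c.
nra.
Qed.

Lemma sqrt_step_lip a c d : rnorm c <= 2^-1 -> rnorm d <= 2^-1 ->
  rnorm (sqrt_step a c - sqrt_step a d) <= 2^-1 * rnorm (c - d).
Proof.
move=> c2 d2; rewrite -scalerBr rnormZ rnormC ger0_norm//.
rewrite ler_pM2l//.
have -> : a + c ** c - (a + d ** d) = c ** (c - d) + (c - d) ** d.
  rewrite opprD addrACA subrr add0r cmulDl cmulDr cmulNl cmulNr.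
  by rewrite addrA subrK.
have := rnormD (c ** (c - d)) ((c - d) ** d).
have := rnorm_cmul c (c - d); have := rnorm_cmul (c - d) d.
have := rnorm_ge0 (c - d).
nra.
Qed.

(** Banach's argument: the iterates from 0 satisfy |u_N - u_(N + m)| <= 2^-N. *)
Lemma sqrt_fixpoint a : rnorm a <= 2^-1 ->
  exists2 c, rnorm c <= 2^-1 & c = sqrt_step a c.
Proof.
move=> a2; pose u n : A := iter n (sqrt_step a) 0.
have u2 n : rnorm (u n) <= 2^-1.
  by elim: n => [|n IH]; [rewrite rnorm0|apply: sqrt_step_ball].
have uD N m : rnorm (u N - u (N + m)%N) <= 2^-1 ^+ N.
  elim: N => [|N IH].
    by rewrite add0n sub0r rnormN expr0; have := u2 m; lra.
  rewrite addSn exprS; apply: le_trans (sqrt_step_lip _ (u2 _) (u2 _)) _.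
  by rewrite ler_pM2l.
have /cauchy_cvgP : cauchy (u @ \oo).
  apply: cauchy_exP => e e0.
  have eE : e = (complex.Re e)%:C by rewrite RRe_real// gtr0_real.
  move: e0; rewrite eE ltcR => e0.
  have [N _ HN] := near_infty_natSinv_expn_lt (PosNum e0).
  exists (u N); exists N => // n /= Nn.
  rewrite -ball_normE/= rnormE ltcR -(subnKC Nn).
  apply: le_lt_trans (uD _ _) _.
  by have := HN N (leqnn _); rewrite /= -exprVn mul1r.
move=> /cvg_ex[c /cvg_rnormP uc].
have c2 : rnorm c <= 2^-1.
  apply/ler_addgt0Pr => e e0; have [N _ /(_ N (leqnn _))/= cN] := uc _ e0.
  by have := rnormD (c - u N) (u N); rewrite subrK; have := u2 N; lra.
exists c => //; apply/eqP; rewrite -subr_eq0; apply/eqP/rnorm0_eq0/eqP.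
rewrite eq_le rnorm_ge0 andbT; apply/ler_addgt0Pr => e e0; rewrite add0r.
have e20 : 0 < e / 2 by rewrite divr_gt0.
have [N _ HN] := uc _ e20.
have cN := HN N (leqnn _); have cN1 := HN N.+1 (leqnSn _).
have := sqrt_step_lip a (u2 N) c2; rewrite -/(u N.+1).
have := rnormD (c - u N.+1) (u N.+1 - sqrt_step a c); rewrite addrA subrK.
rewrite (rdistC (u N)) -/(sqrt_step a c); move: cN cN1; rewrite /=; lra.
Qed.

(** The fixed point c is unique in its ball and star c is another one, so c is
self-adjoint and b = 1 - c is a self-adjoint square root of 1 - a. *)
Lemma one_sub_square a : star a = a -> rnorm a <= 2^-1 ->
  exists b, 1A - a = star b ** b.
Proof.
move=> sa a2; have [c c2 cE] := sqrt_fixpoint a2.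
have sc : star c = c.
  apply/eqP; rewrite -subr_eq0; apply/eqP/rnorm0_eq0.
  have scE : star c = sqrt_step a (star c).
    by rewrite {1}cE /sqrt_step starZ conj_Creal ?complex_real// starD starM sa.
  have := sqrt_step_lip a (c := star c) (d := c).
  rewrite -scE -cE rnorm_star => /(_ c2 c2).
  have := rnorm_ge0 (star c - c); lra.
exists (1A - c); rewrite starD starN star_cone sc.
rewrite cmulDl cmulDr !cmul1x cmulNl cmulDr cmulx1 cmulNr.
have -> : a = c + c - c ** c.
  apply/eqP; rewrite eq_sym subr_eq; apply/eqP.
  rewrite {1 2}cE /sqrt_step -scalerDl -rmorphD/=.
  rewrite (_ : 2^-1 + 2^-1 = 1) ?scale1r//; lra.
by rewrite !opprD !opprK !addrA.
Qed.

End CStar.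

(** * States are uniformly bounded *)

Section States.
Context {R : realType} {A : cstarAlgType R}.

Lemma state_linear (phi : {ptws A -> R[i]^o}) : states A phi ->
  exists f : {linear A -> R[i]^o}, phi = f.
Proof.
move=> [lin _ _].
pose f : {linear A -> R[i]^o} :=
  HB.pack (phi : A -> R[i]^o)
    (GRing.isLinear.Build _ _ _ _ (phi : A -> R[i]^o) lin).
by exists f.
Qed.

Lemma state_le1 (phi : {ptws A -> R[i]^o}) (a : A) : states A phi ->
  star a = a -> rnorm a <= 2^-1 -> phi a <= 1.
Proof.
move=> sphi sa a2; have [b ab] := one_sub_square sa a2.
have [f fE] := state_linear sphi; have [_ pos one] := sphi.
by rewrite -subr_ge0 -one fE -raddfB/= -fE ab pos.
Qed.

(** Scale a to norm 1/2 and apply [state_le1] to it and to its opposite. *)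
Lemma state_bound_sa (phi : {ptws A -> R[i]^o}) (a : A) : states A phi ->
  star a = a -> rnorm (phi a : R[i]) <= 2 * rnorm a.
Proof.
move=> sphi sa; have [f fE] := state_linear sphi.
have [a0|an0] := eqVneq (rnorm a) 0.
  by rewrite (rnorm0_eq0 a0) fE raddf0 !rnorm0 mulr0.
have agt0 : 0 < rnorm a by rewrite lt_def an0 rnorm_ge0.
pose t : R := (2 * rnorm a)^-1.
have t0 : 0 < t by rewrite invr_gt0 mulr_gt0.
pose h := t%:C *: a.
have sh : star h = h by rewrite starZ conj_Creal ?complex_real// sa.
have h2 : rnorm h <= 2^-1.
  by rewrite rnormZ rnormC gtr0_norm// /t invfM -mulrA mulVf// mulr1.
have hle := state_le1 sphi sh h2.
have hge : phi (- h) <= 1.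
  by apply: state_le1 => //; rewrite ?starN ?sh// rnormN.
have fh : phi h = t%:C * phi a by rewrite fE linearZ.
have fhn : phi (- h) = - phi h by rewrite fE raddfN.
have : rnorm (phi h : R[i]) <= 1.
  move: hge hle; rewrite fhn; case: (phi h) => u v.
  rewrite !lecE/= => /andP[_ u1] /andP[/eqP v0 u2].
  by rewrite -v0 rnormC ler_norml; apply/andP; split; lra.
rewrite fh rnormM rnormC gtr0_norm// /t mulrC ler_pdivrMr ?mul1r//.
by rewrite mulr_gt0.
Qed.

(** The best constant is 1; any constant that does not depend on the state
serves for compactness.  This one comes from 2 a = h - i k with h and k
self-adjoint. *)
Lemma state_bound (phi : {ptws A -> R[i]^o}) (a : A) : states A phi ->
  rnorm (phi a : R[i]) <= 4 * rnorm a.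
Proof.
move=> sphi; have [f fE] := state_linear sphi.
pose h := a + star a; pose k := 'i%C *: (a - star a).
have sh : star h = h by rewrite starD starK addrC.
have sk : star k = k.
  rewrite starZ starD starN starK -opprB scalerN -scaleNr; congr (_ *: _).
  by rewrite -[Num.conj _]/(conjc _)/=; simpc.
have hb : rnorm h <= 2 * rnorm a.
  by have := rnormD a (star a); rewrite rnorm_star -/h; lra.
have kb : rnorm k <= 2 * rnorm a.
  have := rnormD a (- star a); rewrite rnormN rnorm_star rnormZ rnorm_i; lra.
have aE : a + a = h - 'i%C *: k.
  rewrite scalerA -expr2 sqr_i scaleN1r opprK addrACA.
  by rewrite subrr addr0.
(* kept folded, so that norms of k are not rewritten as norms of a - star a *)
clearbody h k.
have : rnorm (phi (a + a) : R[i]) <= 2 * rnorm h + 2 * rnorm k.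
  have -> : phi (a + a) = phi h - 'i%C * phi k.
    by rewrite aE fE raddfB; congr (_ - _); exact: linearZ.
  apply: le_trans (rnormD _ _) _; rewrite rnormN rnormM rnorm_i mul1r.
  exact: lerD (state_bound_sa sphi sh) (state_bound_sa sphi sk).
have -> : phi (a + a) = (2 : R)%:C * phi a.
  by rewrite fE raddfD rmorph_nat mulr_natl mulr2n.
rewrite rnormM rnormC normr_nat; lra.
Qed.

End States.

(** * Sequential compactness of the state space *)

Section Compactness.
Context {R : realType} {A : cstarAlgType R}.

Lemma states_closed {T : Type} (F : set_system T) {FF : ProperFilter F}
    (f : T -> {ptws A -> R[i]^o}) (psi : {ptws A -> R[i]^o}) :
  (forall t, states A (f t)) -> (forall a, (fun t => f t a) @ F --> psi a) ->
  states A psi.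
Proof.
move=> sf fpsi; split.
- move=> c a b; apply: (cvg_uniqueC (fpsi _)).
  have -> : (fun t => f t (c *: a + b)) = (fun t => c *: f t a + f t b).
    by apply/funext => t; have [lin _ _] := sf t; exact: lin.
  by apply: cvgD (fpsi b); apply: cvgZr; exact: fpsi.
- by move=> a; apply: (cvg_ge0C _ (fpsi _)) => t; have [_ pos _] := sf t.
- apply: (cvg_uniqueC (fpsi _)).
  have -> : (fun t => f t cone) = (fun=> 1).
    by apply/funext => t; have [_ _] := sf t.
  exact: cvg_cst.
Qed.

(** The set P prescribes which indices the subsequence may use. *)
Lemma states_seq_compact (f : nat -> {ptws A -> R[i]^o}) (P : set nat) :
  separable_space A -> (forall k, states A (f k)) ->
  (forall N, exists2 k, (N <= k)%N & P k) ->
  exists (psi : {ptws A -> R[i]^o}) (n : nat -> nat),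
    [/\ states A psi, {homo n : i j / (i < j)%N}, forall j, P (n j)
      & {ptws, (fun j => f (n j)) @ \oo --> psi}].
Proof.
move=> [D cD dD] sf Pinf.
have Pproper : ProperFilter (within P \oo).
  apply: Build_ProperFilter_ex => B [N _ NB].
  by have [k Nk Pk] := Pinf N; exists k; exact: NB.
(* an ultrafilter on the indices that contains P and all final segments *)
have [U [UU PU]] := ultraFilterLemma Pproper.
have /choice[psi fpsi] :
    forall a, exists z : R[i]^o, (fun k => f k a) @ U --> z.
  move=> a; apply: (@ultra_cvg_bounded _ _ U _ _ (4 * rnorm a)) => k.
  exact: state_bound.
have spsi : states A psi by exact: states_closed sf fpsi.
have [d dE] : exists d : nat -> A, forall a, D a -> exists i, d i = a.
  have [x [_ Dx]] := dD setT ltac:(by exists 0) openT.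
  have /pfcard_geP[D0|[g]] := cD; first by rewrite D0 in Dx.
  by exists g => a /(@surj _ _ _ _ g)[i _ <-]; exists i.
(* the condition on the index k at step j, where m is the index of step j - 1;
   it holds on a set of the ultrafilter, so some k satisfies it *)
pose good j m k := [/\ (m < k)%N, P k &
  forall i, (i <= j)%N -> rnorm (psi (d i) - f k (d i) : R[i]) < j.+1%:R^-1].
have /choice[g gP] : forall jm : nat * nat, exists k, good jm.1 jm.2 k.
  move=> [j m]; apply: (@filter_ex _ U); rewrite /good/=.
  have -> : (fun k => good j m k) = (fun k => (m < k)%N) `&` (P `&`
      (fun k => forall i : 'I_j.+1,
         rnorm (psi (d i) - f k (d i) : R[i]) < j.+1%:R^-1)).
    apply/seteqP; split=> k.
      by case=> mk Pk h; split=> //; split=> // i; exact: h (ltn_ord i).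
    by case=> mk [Pk h]; split=> // i ij; exact: (h (Ordinal (n:=j.+1) ij)).
  apply: filterI; first by apply: PU; exists m.+1 => // k mk _.
  apply: filterI; first by apply: PU; exists 0 => // k _ Pk.
  apply: filter_forall => i; have /cvg_rnormP := fpsi (d i).
  by move=> h; apply: h; rewrite invr_gt0.
pose n := fix n j := if j is j'.+1 then g (j, n j') else g (0, 0)%N.
have nG j : exists m, good j m (n j).
  case: j => [|j]; first by exists 0%N; exact: gP (0, 0)%N.
  by exists (n j); exact: gP (j.+1, n j).
have nP j : P (n j) by have [m []] := nG j.
have nD j i : (i <= j)%N ->
    rnorm (psi (d i) - f (n j) (d i) : R[i]) < j.+1%:R^-1.
  by have [m [_ _]] := nG j; apply.
have nS j : (n j < n j.+1)%N by have [] := gP (j.+1, n j).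
exists psi, n; split=> //.
  by apply: (@homo_ltn _ n (fun x y => x < y)%N) => // y x z; exact: ltn_trans.
(* with b in the dense set: moving psi and f (n j) from a to b costs 4 (e / 18)
   each, the distance of their values at b is at most e / 2, and 17 / 18 < 1 *)
apply/pointwise_cvgP => a; apply/(@cvg_rnormP _ R[i]^o) => e e0.
have e18 : 0 < e / 18 by rewrite divr_gt0.
have [b [Db ab]] : exists b, D b /\ rnorm (a - b) < e / 18.
  have [b [ab Db]] := dD (ball a (e / 18)%:C)
    (ex_intro _ a (ballxx _ (etrans (ltcR _ _) e18))) (ball_open _ _).
  by exists b; split=> //; move: ab; rewrite -ball_normE/= rnormE ltcR.
have [i di] := dE b Db.
have [N _ HN] := near_infty_natSinv_lt (PosNum (divr_gt0 e0 (ltr0n _ 2))).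
exists (maxn i N) => // j /=; rewrite geq_max => /andP[ij Nj].
have lip phi : states A phi -> rnorm (phi a - phi b : R[i]) <= 4 * (e / 18).
  move=> sphi; have [h hE] := state_linear sphi.
  rewrite hE -raddfB/= -hE; apply: le_trans (state_bound _ sphi) _.
  by rewrite ler_pM2l//; exact: ltW.
have fab : rnorm (f (n j) b - f (n j) a : R[i]) <= 4 * (e / 18).
  by rewrite rdistC; exact: lip.
have fb := nD j i ij; rewrite di in fb.
apply: lt_le_trans (rnorm_dist3 (lip _ spsi) fb fab) _.
have hN : j.+1%:R^-1 < e / 2 by exact: HN.
by move: hN (e0); set t := _^-1; lra.
Qed.

End Compactness.

(** * Averages of states and the seminorm of a set of states *)

Section Dynamics.
Context {R : realType} {A : cstarAlgType R}.

Lemma star_automorphism_cone (theta : {linear A -> A}) :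
  star_automorphism theta -> theta cone = cone.
Proof.
move=> [[h _ hK] thM _].
by rewrite -[LHS]cmulx1 -{2}[cone]hK -thM cmul1x hK.
Qed.

Lemma state_Avg {G : topologicalGroupType} (Theta : G -> {linear A -> A})
    (E : {fset G}) (phi : {ptws A -> R[i]^o}) :
  cstar_dynamical_system Theta -> E != fset0 -> states A phi ->
  states A (phi \o Avg Theta E).
Proof.
move=> [aut _ _ _] E0 sphi.
have [f fE] := state_linear sphi; have [lin pos one] := sphi.
have AvgE y : (phi \o Avg Theta E) y =
    (#|` E|%:R : R[i])^-1 * \sum_(g <- E) phi (Theta g y).
  by rewrite /= /Avg fE linearZ/= raddf_sum.
split.
- move=> c y z; rewrite !AvgE mulrCA -mulrDr; congr (_ * _).
  rewrite mulr_sumr -big_split/=; apply: eq_bigr => g _.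
  by rewrite linearP; exact: lin.
- move=> y; rewrite AvgE mulr_ge0 ?invr_ge0 ?ler0n// sumr_ge0// => g _.
  by have [_ thM thS] := aut g; rewrite thM thS pos.
- rewrite AvgE (eq_bigr (fun=> 1)) => [|g _]; last first.
    by rewrite star_automorphism_cone.
  by rewrite big_const_seq count_predT iter_addr_0 mulVf// pnatr_eq0 cardfs_eq0.
Qed.

Context (S : set {ptws A -> R[i]^o}) (hS : S `<=` states A).

Lemma seminorm_ubound y :
  ubound [set ComplexField.Normc.normc (phi y) | phi in S] (4 * rnorm y).
Proof. by move=> _ [phi Sphi <-]; rewrite -rnormc; exact/state_bound/hS. Qed.

Lemma le_seminorm phi y : S phi -> rnorm (phi y : R[i]) <= seminorm S y.
Proof.
move=> Sphi; rewrite rnormc; apply: ub_le_sup; last by exists phi.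
by exists (4 * rnorm y); exact: seminorm_ubound.
Qed.

(** Half of the supremum is exceeded by some element, or the supremum is 0. *)
Lemma seminorm_half y : S !=set0 ->
  exists phi, S phi /\ seminorm S y / 2 <= rnorm (phi y : R[i]).
Proof.
move=> [phi0 Sphi0]; have s0 := le_trans (rnorm_ge0 _) (le_seminorm y Sphi0).
have [sE|sn0] := eqVneq (seminorm S y) 0.
  by exists phi0; split=> //; rewrite sE mul0r rnorm_ge0.
have hsup : has_sup [set ComplexField.Normc.normc (phi y) | phi in S].
  split; first by exists (ComplexField.Normc.normc (phi0 y)), phi0.
  by exists (4 * rnorm y); exact: seminorm_ubound.
have sgt0 : 0 < seminorm S y / 2 by rewrite divr_gt0// lt_def sn0.
have [_ [phi Sphi <-]] := sup_adherent sgt0 hsup.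
rewrite -/(seminorm S y) -rnormc => h; exists phi; split=> //; lra.
Qed.

End Dynamics.

(** * Limit states and the seminorms of averages *)

Theorem theorem4p5 (R : realType) (A : cstarAlgType R)
    (G : topologicalGroupType) (Theta : G -> {linear A -> A})
    (hTheta : cstar_dynamical_system Theta)
    (hA : separable_space A) (hG : amenable R G)
    (F : nat -> {fset G}) (hF : right_folner R F)
    (S : set {ptws A -> R[i]^o}) (hS : S `<=` states A) (hS0 : S !=set0)
    (x : A) (hx : self_adjoint x) (lambda : R) :
  [set psi x | psi in limit_states Theta F S] = [set lambda%:C] <->
  (fun k => seminorm S (Avg Theta (F k) x - lambda%:C *: cone)) @ \oo --> (0 : R).
Proof.
have F0 : forall k, F k != fset0 by case: hF.
set y := fun k => Avg Theta (F k) x - lambda%:C *: cone.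
have phiy phi k : states A phi ->
    phi (y k) = (phi \o Avg Theta (F k)) x - lambda%:C.
  move=> sphi; have [f fE] := state_linear sphi; have [_ _ one] := sphi.
  rewrite fE /y raddfB; congr (_ - _).
  by rewrite -[RHS]mulr1 -one fE; exact: linearZ.
have ycvg (phi : nat -> {ptws A -> R[i]^o}) (n : nat -> nat) psi :
    (forall k, S (phi k)) ->
    {ptws, (fun j => phi (n j) \o Avg Theta (F (n j))) @ \oo --> psi} ->
    (fun j => phi (n j) (y (n j))) @ \oo --> (psi x - lambda%:C : R[i]^o).
  move=> Sphi npsi.
  have -> : (fun j => phi (n j) (y (n j))) =
      (fun j => (phi (n j) \o Avg Theta (F (n j))) x - lambda%:C).
    by apply/funext => j; rewrite phiy//; exact: hS.
  move/pointwise_cvgP : npsi => /(_ x) npsi.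
  exact: (cvgB npsi (cvg_cst (lambda%:C : R[i]^o))).
have limit (phi : nat -> {ptws A -> R[i]^o}) (P : set nat) :
    (forall k, S (phi k)) -> (forall N, exists2 k, (N <= k)%N & P k) ->
    exists2 psi, limit_states Theta F S psi & exists n : nat -> nat,
      [/\ {homo n : i j / (i < j)%N}, forall j, P (n j) &
        (fun j => phi (n j) (y (n j))) @ \oo --> (psi x - lambda%:C : R[i]^o)].
  move=> Sphi Pinf.
  have [|psi [n [spsi nhomo nP npsi]]] :=
    states_seq_compact (f := fun k => phi k \o Avg Theta (F k)) hA _ Pinf.
    by move=> k; apply: state_Avg => //; exact: hS.
  exists psi; first by split=> //; exists phi, n.
  by exists n; split=> //; exact: ycvg.
split=> [iE|ii].
- apply: contrapT => nii.
  have [e e0 Pinf] : exists2 e : R, 0 < e &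
      forall N, exists2 k, (N <= k)%N & e <= seminorm S (y k).
    apply: contrapT => nex; apply: nii; apply/cvgrPdist_lt => e e0.
    apply: contrapT => nnear; apply: nex; exists e => // N.
    apply: contrapT => nk; apply: nnear; exists N => // k /= Nk.
    have [phi Sphi] := hS0.
    have s0 := le_trans (rnorm_ge0 _) (le_seminorm hS (y k) Sphi).
    rewrite sub0r normrN ger0_norm//.
    by rewrite ltNge; apply/negP => ek; apply: nk; exists k.
  have /choice[phi phiP] := fun k => seminorm_half hS (y k) hS0.
  have [psi psiL [n [_ nP /cvg_rnormP npsi]]] :=
    limit phi _ (fun k => (phiP k).1) Pinf.
  have psix : psi x = lambda%:C.
    by have : [set lambda%:C] (psi x) by rewrite -iE; exists psi.
  have e20 : 0 < e / 2 by rewrite divr_gt0.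
  have [N _ /(_ N (leqnn _))/=] := npsi _ e20.
  rewrite psix subrr sub0r rnormN; have := (phiP (n N)).2; have := nP N; lra.
- have limE (phi : nat -> {ptws A -> R[i]^o}) (n : nat -> nat) (z : R[i]^o) :
      (forall k, S (phi k)) -> {homo n : i j / (i < j)%N} ->
      (fun j => phi (n j) (y (n j))) @ \oo --> z -> z = 0.
    move=> Sphi nhomo nz; apply: (cvg_uniqueC nz).
    apply/(@cvg_rnormP _ R[i]^o) => e e0.
    move/cvgrPdist_lt : ii => /(_ _ e0)[N _ HN].
    exists N => // j /= Nj; rewrite sub0r rnormN.
    have nj : (j <= n j)%N.
      elim: j {Nj} => // j IH; exact: leq_ltn_trans IH (nhomo _ _ (ltnSn j)).
    apply: le_lt_trans (le_seminorm hS _ (Sphi _)) _.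
    apply: le_lt_trans (HN (n j) (leq_trans Nj nj)).
    by rewrite sub0r normrN ler_norm.
  apply/seteqP; split=> [_ [psi [spsi [phi [n [Sphi nhomo npsi]]]] <-]|_ ->] /=.
    apply/eqP; rewrite -subr_eq0; apply/eqP; apply: (limE phi n) => //.
    exact: ycvg.
  (* the averages of a single state of S already have a limit state *)
  have [phi0 Sphi0] := hS0.
  have [psi psiL [n [nhomo _ npsi]]] := limit (fun=> phi0) setT (fun=> Sphi0)
    (fun N => ex_intro2 _ _ N (leqnn N) I).
  exists psi => //; apply/eqP; rewrite -subr_eq0; apply/eqP.
  by apply: (limE (fun=> phi0) n).
Qed.
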